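(* Let $X$ and $Y$ be locally compact metric spaces, and let $\phi\colon X\to Y$ and $\psi\colon Y\to X$ be continuous maps. Consider the dynamical systems $f=\psi\phi\colon X\to X$ and $g=\phi\psi\colon Y\to Y$. Let $S\subset X$ be an isolated invariant set for $f$. Then $\phi(S)$ is an isolated invariant set for $g$ and $\operatorname{CT}(S,f)=\operatorname{CT}(\phi(S),g)$.
   Context: For a continuous self-map $f\colon X\to X$ of a locally compact metric space and $M\subset X$, $\operatorname{Inv}(M,f)$ is the set of $x\in M$ for which there is a sequence $\gamma\colon\mathbb{Z}\to M$ with $\gamma(0)=x$ and $\gamma(n+1)=f(\gamma(n))$ for all $n\in\mathbb{Z}$. A set $S\subset X$ is isolated invariant for $f$ if it is compact and has a neighborhood $M$ with $\operatorname{Inv}(M,f)=S$. Quotients: for $\varnothing\ne B\subset A$, $A/B$ is the pointed quotient space with base point $[B]$; $A/\varnothing:=A\sqcup\{*\}$ with base point $*$ (denoted $[\varnothing]$). Index pairs: a pair $(N,L)$ of compact sets $L\subset N\subset X$ is an index pair for $(S,f)$ if $\operatorname{Inv}(\operatorname{cl}(N\setminus L),f)=S\subset\operatorname{int}(N\setminus L)$ and the map $f_{(N,L)}\colon N/L\to N/L$ given by $f_{(N,L)}([x])=[f(x)]$ if $x,f(x)\in N\setminus L$ and $f_{(N,L)}([x])=[L]$ otherwise is continuous. The mapping torus of a continuous map $\kappa\colon P\to P$ is $\operatorname{T}(\kappa):=(P\times[0,1])/\big((x,1)\sim(\kappa(x),0)\big)$. The (unreduced) mapping torus index $\operatorname{CT}(S,f)$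 is the (unpointed) homotopy type of $\operatorname{T}(f_{(N,L)})$ for an index pair $(N,L)$ for $(S,f)$; it does not depend on the choice of index pair. *)

(* Defs.v *)
From HB Require Import structures.
From Stdlib Require Import Relation_Operators.
From mathcomp Require Import all_boot all_order all_algebra generic_quotient.
From mathcomp Require Import all_classical all_reals all_analysis.

Set Implicit Arguments.
Unset Strict Implicit.
Unset Printing Implicit Defensive.

Import Order.TTheory GRing.Theory Num.Theory.
Import numFieldNormedType.Exports.

Local Open Scope classical_set_scope.
Local Open Scope ring_scope.
Local Open Scope quotient_scope.

(** * Isolated invariant sets *)

Section invariant_sets.
Context {X : topologicalType}.
Implicit Types (f : X -> X) (M S : set X).

Definition Inv f M : set X :=
  [set x | exists gamma : int -> X,
     [/\ forall n, M (gamma n), gamma 0 = x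
       & forall n, gamma (n + 1) = f (gamma n)]].

Definition isolated_invariant f S :=
  compact S /\ exists M, S `<=` M^° /\ Inv f M = S.

End invariant_sets.

(** * The pointed quotient [N / L] *)

(* The disjoint union T + {*}.  This is not the library's
   one_point_compactification: here {None} is open. *)
Definition add_point (T : Type) : Type := option T.

Section add_point.
Context {T : topologicalType}.

HB.instance Definition _ := Choice.on (add_point T).

Definition add_point_open : set_system (add_point T) :=
  [set U | open (Some @^-1` U)].

Let add_point_openT : add_point_open setT.
Proof. exact: openT. Qed.

Let add_point_openI : setI_closed add_point_open.
Proof. by move=> A B; exact: openI. Qed.

Let add_point_open_bigU (I : Type) (F : I -> set (add_point T)) :
  (forall i, add_point_open (F i)) -> add_point_open (\bigcup_i F i).
Proof. by move=> oF; apply: bigcup_open => i _; exact: oF. Qed.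

HB.instance Definition _ := isOpenTopological.Build (add_point T)
  add_point_openT add_point_openI add_point_open_bigU.

End add_point.

(* N / L is obtained from N + {*} by collapsing L + {*} to a point, which gives
   N + {*} when L is empty (pair_quotient_set0) and the usual quotient of N
   when it is not (pair_class_surj, pair_class_eqP, pair_quotient_openP). *)
Section pair_quotient.
Context {X : topologicalType} (N L : set X).

Definition collapsed (a : add_point N) : bool :=
  if a is Some x then \val x \in L else true.

Definition collapse_rel' (a b : add_point N) : bool :=
  (a == b) || (collapsed a && collapsed b).

Let collapse_refl : reflexive collapse_rel'.
Proof. by move=> a; rewrite /collapse_rel' eqxx. Qed.

Let collapse_sym : symmetric collapse_rel'.
Proof. by move=> a b; rewrite /collapse_rel' eq_sym andbC. Qed.

Let collapse_trans : transitive collapse_rel'.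
Proof.
move=> b a c /predU1P[->//|] /andP[ca cb] /predU1P[<-|/andP[_ cc]];
by apply/orP; right; rewrite ca.
Qed.

Definition collapse_rel :=
  EquivRel collapse_rel' collapse_refl collapse_sym collapse_trans.

Definition pair_quotient := {eq_quot collapse_rel}.

HB.instance Definition _ :=
  Topological.copy pair_quotient (quotient_topology pair_quotient).
HB.instance Definition _ := Quotient.on pair_quotient.

Definition pair_base : pair_quotient := \pi_pair_quotient None.

(* [insub] sends x to Some x if x is in N and to None otherwise, so a point
   outside N is sent to the base point. *)
Definition pair_class (x : X) : pair_quotient :=
  \pi_pair_quotient (insub x : option N).

Lemma pair_class_base (x : X) : (~ N x \/ L x) -> pair_class x = pair_base.
Proof.
move=> h; apply/eqmodP/orP; right; rewrite andbT.
case: insubP => [u _ ux|//] /=; rewrite ux.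
case: h => [Nx|Lx]; last exact: mem_set.
by case: Nx; rewrite -ux; exact: set_mem (valP u).
Qed.

Lemma pair_classE (x : N) : pair_class (\val x) = \pi_pair_quotient (Some x).
Proof. by rewrite /pair_class valK. Qed.

Lemma pair_class_eqP (x y : X) : N x -> N y ->
  pair_class x = pair_class y <-> x = y \/ L x /\ L y.
Proof.
move=> /mem_set Nx /mem_set Ny; rewrite /pair_class !insubT.
split=> [/eqmodP/orP[/eqP[]|/andP[/= /set_mem ? /set_mem ?]]|].
- by left.
- by right.
- by move=> e; apply/eqmodP/orP; case: e => [?|[? ?]];
    [left; subst; apply/eqP; congr Some; exact: val_inj
    |right; apply/andP; split; exact: mem_set].
Qed.

Lemma pair_class_surj (c : pair_quotient) :
  c = pair_base \/ exists2 x, N x & c = pair_class x.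
Proof.
rewrite -[c]reprK; case: (repr c) => [x|]; last by left.
by right; exists (\val x); [exact: set_mem (valP x)|rewrite pair_classE].
Qed.

Lemma pair_class_surj_neq0 (c : pair_quotient) : N `&` L !=set0 ->
  exists2 x, N x & c = pair_class x.
Proof.
move=> [y [Ny Ly]]; case: (pair_class_surj c) => // ->.
by exists y => //; rewrite pair_class_base//; right.
Qed.

Lemma pair_quotient_openP (U : set pair_quotient) :
  open U <-> open [set x : N | U (pair_class (\val x))].
Proof.
have -> : [set x : N | U (pair_class (\val x))] =
          Some @^-1` (\pi_pair_quotient @^-1` U).
  by apply/seteqP; split=> x /=; rewrite pair_classE.
by [].
Qed.

Lemma pair_quotient_set0 : L = set0 -> injective (\pi_pair_quotient).
Proof.
move=> L0 a b /eqmodP/predU1P[//|/andP[]].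
by case: a => [x|]; case: b => [y|] //=; rewrite ?L0 ?in_set0.
Qed.

End pair_quotient.

(** * Index pairs *)

Section index_pairs.
Context {X : topologicalType} (f : X -> X).

Definition index_map (N L : set X) (c : pair_quotient N L) :
    pair_quotient N L :=
  if repr c is Some x then
    if `[< (N `\` L) (\val x) /\ (N `\` L) (f (\val x)) >]
    then pair_class N L (f (\val x)) else pair_base N L
  else pair_base N L.

Lemma index_mapE (N L : set X) (x : X) :
  (N `\` L) x -> (N `\` L) (f x) ->
  index_map (pair_class N L x) = pair_class N L (f x).
Proof.
move=> [Nx Lx] fx; rewrite /index_map.
have : pair_class N L x = \pi_(pair_quotient N L) (repr (pair_class N L x)) by rewrite reprK.
have Nx' := mem_set Nx.
rewrite {1}/pair_class insubT => /eqmodP/predU1P[<-/=|/andP[/= /set_mem//]].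
by rewrite asboolT.
Qed.

Lemma index_map_base (N L : set X) : index_map (pair_base N L) = pair_base N L.
Proof.
rewrite /index_map.
have : pair_base N L = \pi_(pair_quotient N L) (repr (pair_base N L)) by rewrite reprK.
case: (repr _) => // x /eqmodP/predU1P[//|/andP[_ /= /set_mem Lx]].
by case: asboolP => // -[[]].
Qed.

Lemma index_map_exit (N L : set X) (x : X) :
  ~ ((N `\` L) x /\ (N `\` L) (f x)) ->
  index_map (pair_class N L x) = pair_base N L.
Proof.
move=> nx; have [Nx|Nx] := pselect (N x); last first.
  by rewrite pair_class_base ?index_map_base//; left.
have [Lx|Lx] := pselect (L x).
  by rewrite pair_class_base ?index_map_base//; right.
rewrite /index_map.
have : pair_class N L x = \pi_(pair_quotient N L) (repr (pair_class N L x)) by rewrite reprK.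
have Nx' := mem_set Nx.
rewrite {1}/pair_class insubT => /eqmodP/predU1P[<-/=|/andP[/= /set_mem//]].
by rewrite asboolF.
Qed.

Record index_pair (S N L : set X) : Prop := IndexPair {
  index_pair_compactN : compact N;
  index_pair_compactL : compact L;
  index_pair_sub : L `<=` N;
  index_pair_Inv : Inv f (closure (N `\` L)) = S;
  index_pair_interior : S `<=` (N `\` L)^°;
  index_pair_continuous : continuous (@index_map N L)
}.

End index_pairs.

(** * Mapping tori *)

Section generated_equivalence.
Context {T : choiceType} (r : T -> T -> Prop).

Definition generated_rel' (x y : T) : bool := `[< clos_refl_sym_trans T r x y >].

Let generated_refl : reflexive generated_rel'.
Proof. by move=> x; apply/asboolP; exact: rst_refl. Qed.

Let generated_sym : symmetric generated_rel'.
Proof. by move=> x y; apply/asboolP/asboolP; exact: rst_sym. Qed.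

Let generated_trans : transitive generated_rel'.
Proof. by move=> y x z /asboolP ? /asboolP ?; apply/asboolP/(rst_trans _ _ _ y). Qed.

Definition generated_rel :=
  EquivRel generated_rel' generated_refl generated_sym generated_trans.

End generated_equivalence.

Definition unit_interval (R : realType) : set R := [set x | 0 <= x <= 1].
Arguments unit_interval : clear implicits.

Section mapping_torus.
Context (R : realType) {P : topologicalType} (k : P -> P).

Definition torus_glue (a b : P * unit_interval R) : Prop :=
  [/\ \val a.2 = 1, b.1 = k a.1 & \val b.2 = 0].

Definition mapping_torus := {eq_quot (generated_rel torus_glue)}.

HB.instance Definition _ :=
  Topological.copy mapping_torus (quotient_topology mapping_torus).
HB.instance Definition _ := Quotient.on mapping_torus.

End mapping_torus.

(** * Homotopy types *)

Section homotopy.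
Context (R : realType).

Definition homotopic (A B : topologicalType) (u v : A -> B) :=
  exists H : A * unit_interval R -> B,
    [/\ continuous H,
        forall x t, \val t = 0 -> H (x, t) = u x
      & forall x t, \val t = 1 -> H (x, t) = v x].

Definition homotopy_equivalent (A B : topologicalType) :=
  exists (u : A -> B) (v : B -> A),
    [/\ continuous u, continuous v,
        homotopic (v \o u) idfun & homotopic (u \o v) idfun].

(* Classes of spaces are plain predicates because [set topologicalType] is a
   universe inconsistency. *)
Definition is_homotopy_type (C : topologicalType -> Prop) :=
  exists Z, C = (fun Z' => homotopy_equivalent Z' Z).

(* All index pairs contribute to CT, so that [is_homotopy_type (CT f S)] says
   that there is an index pair and that the homotopy type of its mapping torus
   does not depend on it. *)
Definition CT (X : topologicalType) (f : X -> X) (S : set X)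
    (Z : topologicalType) : Prop :=
  exists N L : set X, index_pair f S N L /\
    homotopy_equivalent Z (mapping_torus R (index_map f (N := N) (L := L))).

End homotopy.

(* Main.v *)
(* If M isolates S for f = psi phi, then M' = psi^-1 M isolates phi(S) for
   g = phi psi.  Index pairs exist by an argument with pseudo-orbits.  Given an
   index pair (N, L) for S and an index pair (N', L') for phi(S), for large n
   the map r sending [x] to [phi (f^(3n) x)] when x, ..., f^(2n) x lie in N \ L
   and phi (f^n x), ..., phi (f^(3n) x) lie in N' \ L', and to the base point
   otherwise, is continuous and intertwines the two index maps.  With the map s
   obtained by exchanging the roles of the two pairs, s r and r s are the
   (6n+1)st powers of the index maps.  Such a shift equivalence induces a
   homotopy equivalence of mapping tori, because the map of the torus induced by
   the map itself is homotopic to the identity along the suspension flow.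
   Independence of the index pair is the case where two index pairs of S are
   compared with the same index pair of phi(S). *)

Require Import Defs.
From mathcomp Require Import all_boot all_order all_algebra.
From mathcomp Require Import all_classical all_reals all_analysis.
From mathcomp Require Import generic_quotient zify lra.
From Stdlib Require Import Relation_Operators.

Local Open Scope classical_set_scope.

Set Implicit Arguments.
Unset Strict Implicit.
Unset Printing Implicit Defensive.

Import Order.TTheory GRing.Theory Num.Theory.
Import numFieldNormedType.Exports.

Local Open Scope ring_scope.
Local Open Scope quotient_scope.

(** * Homotopies and mapping tori *)

Section homotopy_calculus.
Context {R : realType}.
Local Notation I := (unit_interval R).

Lemma clamp_subproof (r : R) : unit_interval R (Num.min 1 (Num.max 0 r)).
Proof. by rewrite /unit_interval/= le_min ler01 le_max lexx/= ge_min lexx. Qed.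

(** Retracts the line onto [I], so that homotopies can use real arithmetic on times. *)
Definition clamp (r : R) : I := SigSub (mem_set (clamp_subproof r)).

Lemma clampE (r : R) : 0 <= r <= 1 -> \val (clamp r) = r.
Proof.
by move=> /andP[r0 r1]; rewrite /clamp/= (max_idPr r0) (min_idPr r1).
Qed.

Lemma clamp0 : \val (clamp 0) = 0.
Proof. by apply: clampE; lra. Qed.

Lemma clamp1 : \val (clamp 1) = 1.
Proof. by apply: clampE; lra. Qed.

Lemma itv01 (t : I) : 0 <= \val t <= 1.
Proof. exact: set_mem (valP t). Qed.

Lemma clamp_val (t : I) : clamp (\val t) = t.
Proof. by apply: val_inj; rewrite clampE// itv01. Qed.

Lemma clamp_continuous : continuous clamp.
Proof.
apply: continuous_comp_initial => r.
apply: (@continuous_min R R^o (cst 1) (Num.max 0) r); first exact: cvg_cst.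
by apply: (@continuous_max R R^o (cst 0) id r); [exact: cvg_cst|exact: cvg_id].
Qed.

Lemma continuous_clamp (T : topologicalType) (u : T -> R) :
  continuous u -> continuous (clamp \o u).
Proof.
by move=> cu x; apply: continuous_comp; [exact: cu|exact: clamp_continuous].
Qed.

Lemma val_continuous (T : topologicalType) (A : set T) :
  continuous (\val : A -> T).
Proof. exact: initial_continuous. Qed.

Lemma continuous_pair (T A B : topologicalType) (u : T -> A) (v : T -> B) :
  continuous u -> continuous v -> continuous (fun x => (u x, v x)).
Proof. by move=> cu cv x; apply: cvg_pair; [exact: cu|exact: cv]. Qed.

Lemma continuous_compT (A B C : topologicalType) (u : A -> B) (v : B -> C) :
  continuous u -> continuous v -> continuous (v \o u).
Proof. by move=> cu cv x; apply: continuous_comp; [exact: cu|exact: cv]. Qed.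

Lemma continuous_fst (A B : topologicalType) : continuous (@fst A B).
Proof. by move=> x; exact: cvg_fst. Qed.

Lemma continuous_snd (A B : topologicalType) : continuous (@snd A B).
Proof. by move=> x; exact: cvg_snd. Qed.

(** Pasting along [c x = 1]: near such a point both [u] and [v] are close to their common value,
    whichever branch is taken. *)
Lemma continuous_if_le (T U : topologicalType) (c : T -> R) (u v : T -> U) :
  continuous c -> continuous u -> continuous v ->
  (forall x, c x = 1 -> u x = v x) ->
  continuous (fun x => if c x <= 1 then u x else v x).
Proof.
move=> cc cu cv uv x W /= Wx.
have [cx|cx|cx] := ltgtP (c x) 1; move: Wx.
- rewrite (ltW cx) => /cu; have : \forall y \near x, c y < 1.
    exact: (cvgr_lt (c x) (cc x)).
  by apply: filterS2 => y /ltW yc Wy /=; rewrite yc.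
- rewrite leNgt cx /= => /cv; have : \forall y \near x, 1 < c y.
    exact: (cvgr_gt (c x) (cc x)).
  by apply: filterS2 => y yc Wy /=; rewrite leNgt yc.
- rewrite cx lexx => Wx; have := Wx; rewrite uv// => /cv.
  move: Wx => /cu; apply: (@filterS2 _ (nbhs x) _ (u @^-1` W) (v @^-1` W)).
  by move=> y uy vy /=; case: ifP.
Qed.

Lemma homotopic_trans (A B : topologicalType) (u v w : A -> B) :
  homotopic R u v -> homotopic R v w -> homotopic R u w.
Proof.
move=> [H [cH H0 H1]] [K [cK K0 K1]].
have ct : continuous (fun x : A * I => \val x.2 * 2 : R).
  move=> x; apply: cvgM; last exact: cvg_cst.
  by apply: (continuous_comp (@continuous_snd _ _ x)); exact: val_continuous.
exists (fun x => if \val x.2 * 2 <= 1 then H (x.1, clamp (\val x.2 * 2))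
                 else K (x.1, clamp (\val x.2 * 2 - 1))); split.
- apply: continuous_if_le => //.
  + apply: (continuous_compT (u := fun x : A * I => (x.1, _))) cH.
    apply: continuous_pair; first exact: continuous_fst.
    exact: (continuous_clamp ct).
  + apply: (continuous_compT (u := fun x : A * I => (x.1, _))) cK.
    apply: continuous_pair; first exact: continuous_fst.
    apply: (@continuous_clamp _ (fun x : A * I => \val x.2 * 2 - 1)) => x.
    by apply: cvgB; [exact: ct|exact: cvg_cst].
  + by move=> x e; rewrite e subrr H1 ?K0// clampE ?lexx ?ler01.
- by move=> x t t0 /=; rewrite t0 mul0r ler01 H0// clampE ?lexx ?ler01.
- move=> x t t1 /=; rewrite t1 mul1r.
  have -> : (2 <= 1 :> R) = false by apply/negbTE; rewrite -ltNge; lra.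
  by rewrite K1// clampE; lra.
Qed.

Lemma homotopic_comp (A A' B B' : topologicalType) (u v : A -> B)
    (a : A' -> A) (b : B -> B') :
  continuous a -> continuous b -> homotopic R u v ->
  homotopic R (b \o u \o a) (b \o v \o a).
Proof.
move=> ca cb [H [cH H0 H1]]; exists (fun x => b (H (a x.1, x.2))); split.
- apply: (continuous_compT (u := fun x : A' * I => H (a x.1, x.2))) cb.
  apply: (continuous_compT (u := fun x : A' * I => (a x.1, x.2))) cH.
  apply: continuous_pair; last exact: continuous_snd.
  exact: continuous_compT (@continuous_fst _ _) ca.
- by move=> x t t0; rewrite /= H0.
- by move=> x t t1; rewrite /= H1.
Qed.

Lemma homotopic_sym (A B : topologicalType) (u v : A -> B) :
  homotopic R u v -> homotopic R v u.
Proof.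
move=> [H [cH H0 H1]]; exists (fun x => H (x.1, clamp (1 - \val x.2))); split.
- apply: (continuous_compT (u := fun x : A * I => (x.1, _))) cH.
  apply: continuous_pair; first exact: continuous_fst.
  apply: (@continuous_clamp _ (fun x : A * I => 1 - \val x.2)) => x.
  apply: cvgB; first exact: cvg_cst.
  by apply: (continuous_comp (@continuous_snd _ _ x)); exact: val_continuous.
- by move=> x t t0; rewrite /= H1// clampE t0; lra.
- by move=> x t t1; rewrite /= H0// clampE t1; lra.
Qed.

Lemma homotopy_equivalent_sym (A B : topologicalType) :
  homotopy_equivalent R A B -> homotopy_equivalent R B A.
Proof. by move=> [u [v [cu cv vu uv]]]; exists v, u. Qed.

Lemma homotopy_equivalent_trans (A B C : topologicalType) :
  homotopy_equivalent R A B -> homotopy_equivalent R B C ->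
  homotopy_equivalent R A C.
Proof.
move=> [u [v [cu cv vu uv]]] [u' [v' [cu' cv' vu' uv']]].
exists (u' \o u), (v \o v'); split.
- exact: continuous_compT cu cu'.
- exact: continuous_compT cv' cv.
- exact: homotopic_trans (homotopic_comp cu cv vu') vu.
- exact: homotopic_trans (homotopic_comp cv' cu' uv) uv'.
Qed.

End homotopy_calculus.

Section unit_interval_topology.
Context (R : realType).
Local Notation I := (unit_interval R).

Lemma unit_interval_compact : compact [set: I].
Proof.
have -> : [set: I] = clamp @` `[0%R, 1%R].
  apply/seteqP; split=> // t _; exists (\val t); last exact: clamp_val.
  by rewrite /= in_itv/= itv01.
apply: continuous_compact; last exact: segment_compact.
by apply: continuous_subspaceT; exact: clamp_continuous.
Qed.

Lemma unit_interval_locally_compact : locally_compact [set: I].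
Proof.
move=> t _; rewrite withinET; exists setT; first exact: filterT.
by split; [exact: unit_interval_compact|exact: closedT].
Qed.

Lemma unit_interval_regular : regular_space I.
Proof. exact: uniform_regular. Qed.

End unit_interval_topology.

(** * Maps and homotopies out of a mapping torus *)

Section mapping_torus_maps.
Context {R : realType} {P : topologicalType} (k : P -> P).
Local Notation I := (unit_interval R).
Local Notation T := (mapping_torus R k).
Local Notation piT := (\pi_(mapping_torus R k)).

Lemma torus_glue_eq (a b : P * I) : torus_glue k a b -> piT a = piT b.
Proof. by move=> ab; apply/eqmodP/asboolP; exact: rst_step. Qed.

(** Invariance under one glueing step propagates along the generated equivalence, so the
    representative picked by [repr] is irrelevant. *)
Lemma torus_reprE (Z : Type) (h : P * I -> Z) a :
  (forall a b, torus_glue k a b -> h a = h b) -> h (repr (piT a)) = h a.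
Proof.
move=> hk; have /eqmodP/asboolP : piT (repr (piT a)) = piT a by rewrite reprK.
have H x y : clos_refl_sym_trans _ (torus_glue k) x y -> h x = h y.
  by elim=> [? ? /hk| | |] // ? ? ? _ -> _ ->.
exact: H.
Qed.

Lemma torus_repr_continuous (Z : topologicalType) (h : P * I -> Z) :
  continuous h -> (forall a b, torus_glue k a b -> h a = h b) ->
  continuous (fun c : T => h (repr c)).
Proof.
move=> ch hk; apply: repr_comp_continuous => // a b /eqP ab.
by apply/eqP; rewrite -(torus_reprE a hk) -(torus_reprE b hk) ab.
Qed.

Section torus_homotopy.
Import ArrowAsCompactOpen.

(* [I] being locally compact, currying turns the homotopy into a map from the
   quotient to a function space; this avoids showing that a quotient map times
   [I] is a quotient map. *)
Lemma torus_homotopy_continuous (Z : topologicalType) (h : (P * I) * I -> Z) :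
  continuous h -> (forall a b s, torus_glue k a b -> h (a, s) = h (b, s)) ->
  continuous (fun x : T * I => h (repr x.1, x.2)).
Proof.
move=> ch hk; have [cch chs] := continuous_curry ch.
have -> : (fun x : T * I => h (repr x.1, x.2)) =
    uncurry (fun c : T => curry h (repr c)) by apply/funext => -[].
apply: continuous_uncurry_regular.
- exact: unit_interval_locally_compact.
- exact: unit_interval_regular.
- apply: torus_repr_continuous cch _ => a b ab.
  by apply/funext => s; exact: hk.
- by move=> c; exact: chs.
Qed.

End torus_homotopy.

(** The homotopy is the suspension flow up to time 1: a point rises in its fibre and, on passing
    level 1, continues from the bottom at its [k]-image. *)
Lemma torus_homotopic_step : continuous k ->
  homotopic R idfun (fun c : T => piT (k (repr c).1, (repr c).2)).
Proof.
move=> ck; pose h (x : (P * I) * I) : T :=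
  if \val x.1.2 + \val x.2 <= 1 then piT (x.1.1, clamp (\val x.1.2 + \val x.2))
  else piT (k x.1.1, clamp (\val x.1.2 + \val x.2 - 1)).
have pi_glue x : piT (x, clamp 1) = piT (k x, clamp 0).
  by apply: torus_glue_eq; split=> //; [exact: clamp1|exact: clamp0].
have h0 (a : P * I) t : \val t = 0 -> h (a, t) = piT a.
  case: a => x s t0; rewrite /h /= t0 addr0 clamp_val.
  by have /andP[_ ->] := itv01 s.
exists (fun x : T * I => h (repr x.1, x.2)); split.
- apply: torus_homotopy_continuous.
    have c1 : continuous (fun x : (P * I) * I => x.1.1).
      exact: continuous_compT (@continuous_fst _ _) (@continuous_fst _ _).
    have cs : continuous (fun x : (P * I) * I => \val x.1.2 + \val x.2 : R).
      move=> x; apply: cvgD.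
        apply: (continuous_compT (u := fun x : (P * I) * I => x.1.2)
          _ (@val_continuous _ _)).
        exact: continuous_compT (@continuous_fst _ _) (@continuous_snd _ _).
      exact: (continuous_compT (@continuous_snd _ _) (@val_continuous _ _)).
    apply: continuous_if_le => //.
    + apply: (continuous_compT (u := fun x : (P * I) * I => (x.1.1, _)))
        (@pi_continuous _ _).
      by apply: continuous_pair => //; exact: (continuous_clamp cs).
    + apply: (continuous_compT (u := fun x : (P * I) * I => (k x.1.1, _)))
        (@pi_continuous _ _).
      apply: continuous_pair; first exact: continuous_compT c1 ck.
      apply: (@continuous_clamp _ _
        (fun x : (P * I) * I => \val x.1.2 + \val x.2 - 1)) => x.
      by apply: cvgB; [exact: cs|exact: cvg_cst].
    + by move=> x e; rewrite e subrr pi_glue.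
  (* Compatibility with the glueing: for [u > 0] the point at level 1 takes the second branch and
     agrees with the first branch at level 0; at [u = 0] neither point moves, and they are equal in
     the torus. *)
  move=> [x s] [y t] u [/= s1 -> t0].
  have /andP[] := itv01 u; rewrite le_eqVlt => /predU1P[/esym u0 _|u0 u1].
    by rewrite !h0//; apply: torus_glue_eq.
  rewrite /h /= s1 t0 add0r u1 ifF; last by rewrite gerDl leNgt u0.
  by rewrite addrAC subrr add0r.
- by move=> c t t0; rewrite /= h0// reprK.
- move=> c t t1; rewrite /= /h /= t1 addrK clamp_val.
  (* At time 1 the first branch forces [s = 0], where the flow has just reached level 1, glued to
     the bottom. *)
  case: ifP => // s0; case: (repr c) s0 => x s /= s0.
  have {}s0 : \val s = 0.
    by apply/le_anti; move: s0; rewrite gerDr => ->; case/andP: (itv01 s).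
  by rewrite s0 add0r pi_glue -s0 clamp_val.
Qed.

End mapping_torus_maps.

Section torus_maps.
Context {R : realType} {P Q : topologicalType} (k : P -> P) (l : Q -> Q).
Local Notation I := (unit_interval R).

(** Written on chosen representatives; the choice is immaterial once [r] intertwines [k] and [l]. *)
Definition torus_map (r : P -> Q) (c : mapping_torus R k) : mapping_torus R l :=
  \pi_(mapping_torus R l) (r (repr c).1, (repr c).2).

Context (r : P -> Q) (rk : forall x, r (k x) = l (r x)).

Let torus_glue_map (a b : P * I) : torus_glue k a b ->
  \pi_(mapping_torus R l) (r a.1, a.2) = \pi_(mapping_torus R l) (r b.1, b.2).
Proof. by move=> [a1 -> b0]; apply: torus_glue_eq; split => //=. Qed.

Lemma torus_mapE (a : P * I) : torus_map r (\pi_(mapping_torus R k) a) =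
  \pi_(mapping_torus R l) (r a.1, a.2).
Proof.
rewrite /torus_map; apply: (torus_reprE
  (h := fun a => \pi_(mapping_torus R l) (r a.1, a.2))); exact: torus_glue_map.
Qed.

Lemma torus_map_continuous : continuous r -> continuous (torus_map r).
Proof.
move=> cr; apply: (torus_repr_continuous
  (h := fun a : P * I => \pi_(mapping_torus R l) (r a.1, a.2))) => //.
apply: (continuous_compT (u := fun a : P * I => (r a.1, a.2)))
  (@pi_continuous _ _).
apply: continuous_pair; last exact: continuous_snd.
exact: continuous_compT (@continuous_fst _ _) cr.
Qed.

End torus_maps.

Arguments torus_map R {P Q} k l r c.

(** * Shift equivalences induce homotopy equivalences of tori *)

Section shift_equivalence.
Context {R : realType}.

(** Induction on [m]: each factor of [k] is removed by one unit of the suspension flow. *)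
Lemma torus_map_iter_homotopic (P : topologicalType) (k : P -> P) (m : nat) :
  continuous k ->
  homotopic R (torus_map R k k (iter m k)) idfun.
Proof.
move=> ck; elim: m => [|m IHm].
  have -> : torus_map R k k (iter 0 k) = @idfun (mapping_torus R k).
    by apply/funext => c; rewrite /torus_map/= -surjective_pairing reprK.
  by exists (fun x => x.1); split=> //; exact: continuous_fst.
apply: homotopic_trans IHm.
have -> : torus_map R k k (iter m.+1 k) =
    torus_map R k k k \o (torus_map R k k (iter m k)).
  by apply/funext => c; rewrite /= {3}/torus_map torus_mapE.
apply: (homotopic_comp (u := torus_map R k k k) (v := idfun) (b := idfun)) =>
  //.
  apply: torus_map_continuous => //; first by move=> x; rewrite -iterSr.
  by elim: m => [|m IHm] x; [exact: cvg_id|apply: (continuous_compT IHm ck)].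
  by move=> x; exact: cvg_id.
exact: homotopic_sym (torus_homotopic_step ck).
Qed.

(** On the tori the composites of the maps induced by [r] and [s] are induced by [m]-th powers,
    which flow back to the identity. *)
Lemma shift_equivalent_torus (P Q : topologicalType) (k : P -> P) (l : Q -> Q)
    (r : P -> Q) (s : Q -> P) (m : nat) :
  continuous k -> continuous l -> continuous r -> continuous s ->
  (forall x, r (k x) = l (r x)) -> (forall y, s (l y) = k (s y)) ->
  (forall x, s (r x) = iter m k x) -> (forall y, r (s y) = iter m l y) ->
  homotopy_equivalent R (mapping_torus R k) (mapping_torus R l).
Proof.
move=> ck cl cr cs rk sl sr rs.
exists (torus_map R k l r), (torus_map R l k s); split.
- exact: torus_map_continuous.
- exact: torus_map_continuous.
- have -> : torus_map R l k s \o torus_map R k l r =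
      (torus_map R k k (iter m k)).
    by apply/funext => c; rewrite /= {2}/torus_map torus_mapE//= sr.
  exact: torus_map_iter_homotopic.
- have -> : torus_map R k l r \o torus_map R l k s =
      (torus_map R l l (iter m l)).
    by apply/funext => c; rewrite /= {2}/torus_map torus_mapE//= rs.
  exact: torus_map_iter_homotopic.
Qed.

End shift_equivalence.

(** * Existence of index pairs *)

Section invariant_set_theory.
Context {X : topologicalType} (f : X -> X).

Lemma Inv_mono (M M' : set X) : M `<=` M' -> Defs.Inv f M `<=` Defs.Inv f M'.
Proof. by move=> MM' x [g [Mg g0 gS]]; exists g; split=> // n; exact: MM'. Qed.

Lemma Inv_orbit (M : set X) (g : int -> X) : (forall n, M (g n)) ->
  (forall n, g (n + 1) = f (g n)) -> forall n, Defs.Inv f M (g n).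
Proof.
move=> Mg gS n; exists (fun k => g (n + k)); split=> //; first by rewrite addr0.
by move=> k; rewrite addrA gS.
Qed.

(** Every point of a full orbit in [M] lies in [Inv f M], so the orbit already stays in [A]. *)
Lemma Inv_idem (M A : set X) :
  Defs.Inv f M `<=` A -> A `<=` M -> Defs.Inv f A = Defs.Inv f M.
Proof.
move=> IA AM; apply/seteqP; split; first exact: Inv_mono.
by move=> x [g [Mg g0 gS]]; exists g; split=> // n; apply: IA; exact: Inv_orbit.
Qed.

Lemma Inv_image (M : set X) : f @` Defs.Inv f M = Defs.Inv f M.
Proof.
apply/seteqP; split=> [_ [x [g [Mg <- gS]] <-]|x [g [Mg <- gS]]].
  by rewrite -gS; exact: Inv_orbit.
by exists (g (-1)); [exact: Inv_orbit|rewrite -gS addNr].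
Qed.

End invariant_set_theory.

(** If [A] is in a finer filter [G] but its preimage is not in [F], then the preimage of the
    complement is, and [G] would contain two disjoint sets. *)
Lemma ultra_fmap (T U : Type) (g : T -> U) (F : set_system T) :
  UltraFilter F -> UltraFilter (g @ F).
Proof.
move=> UF; apply: Build_UltraFilter => G PG FG; apply/seteqP; split=> // A GA.
have [//|FA] := in_ultra_setVsetC (g @^-1` A) UF.
have : G (A `&` ~` A) by apply: filterI => //; exact: FG.
by rewrite setICr => /filter_not_empty.
Qed.

Section bi_infinite_chain.
Context {T : Type} (A B : set T) (r : T -> T -> Prop).

(** Choices are iterated backwards in [A] and forwards in [B], and joined at [x]; [Negz n] is
    [-(n+1)], hence [n.+1] predecessors. *)
Lemma bi_infinite_chain (x : T) :
  (forall a, A a -> exists2 a', A a' & r a' a) ->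
  (forall b, B b -> exists2 b', B b' & r b b') -> A x -> B x ->
  exists g : int -> T, [/\ g 0 = x, forall k, (A `|` B) (g k)
                         & forall k, r (g k) (g (k + 1))].
Proof.
move=> predA succB Ax Bx.
have /choice[p pP] : forall a, exists b, A a -> A b /\ r b a.
  move=> a; have [/predA[b Ab rb]|nA] := pselect (A a); first by exists b.
  by exists a.
have /choice[q qP] : forall a, exists b, B a -> B b /\ r a b.
  move=> a; have [/succB[b Bb rb]|nB] := pselect (B a); first by exists b.
  by exists a.
have Ap n : A (iter n p x) by elim: n => //= n /pP[].
have Bq n : B (iter n q x) by elim: n => //= n /qP[].
exists (fun k =>
  match k with Posz n => iter n q x | Negz n => iter n.+1 p x end).
split=> // [[n|n]|[n|[|n]]].
- by right.
- by left; exact: Ap.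
- by rewrite -PoszD addn1; have [] := qP _ (Bq n).
- by have [] := pP _ Ax.
- have -> : Negz n.+1 + 1 = Negz n by lia.
  by have [] := pP _ (Ap n.+1).
Qed.

End bi_infinite_chain.

(** * Isolation of long pseudo-orbits and orbits *)

Section isolation.
Context {R : realType} {X : metricType R} (f : X -> X) (cf : continuous f).

(* A compactness argument: pseudo-orbits with smaller and smaller jumps on
   larger and larger windows converge along an ultrafilter to a full orbit. *)
Lemma pseudo_orbit_isolation (M V : set X) :
  compact M -> Defs.Inv f M `<=` V^° ->
  exists n, forall g : int -> X, (forall k, (absz k <= n)%N -> M (g k)) ->
    (forall k, (absz k <= n)%N -> ball (f (g k)) n.+1%:R^-1 (g (k + 1))) ->
    V (g 0).
Proof.
rewrite compact_ultra => cM IV; apply: contrapT => /forallNP nV.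
have {nV} /choice[g gP] : forall n, exists g : int -> X,
    [/\ forall k, (absz k <= n)%N -> M (g k),
        forall k, (absz k <= n)%N -> ball (f (g k)) n.+1%:R^-1 (g (k + 1))
      & ~ V (g 0)].
  move=> n; have := nV n => /existsNP[g] /not_implyP[Mg] /not_implyP[bg Vg].
  by exists g.
(* A single ultrafilter makes the points at all times [k] converge at once, in place of a diagonal
   extraction. *)
have [G [UG ooG]] := @ultraFilterLemma _ (\oo) _.
have Gk k : G (fun n => absz k <= n)%N by apply: ooG; exists (absz k).
have /choice[d dP] : forall k, exists p, M p /\ g n k @[n --> G] --> p.
  move=> k; have [|p [Mp gp]] := cM _ (ultra_fmap (g ^~ k) UG).
    apply: (filterS (P := fun n => absz k <= n)%N) => // n kn.
    by have [+ _ _] := gP n; exact.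
  by exists p.
have dS k : d (k + 1) = f (d k).
  (* The error [e] is split into [e/4] for each of the two limits and [e/2] for the jump. *)
  apply/esym/(close_eq (@metric_hausdorff _ X)); rewrite ball_close => e.
  have e4 : 0 < e%:num / 4 by rewrite divr_gt0.
  have e2 : 0 < e%:num / 2 by rewrite divr_gt0.
  near G => n.
  have b1 : ball (f (d k)) (e%:num / 4) (f (g n k)).
    near: n; have [_ gk] := dP k.
    have fk : f (g n k) @[n --> G] --> f (d k).
      by apply: cvg_comp gk _; exact: cf.
    by apply: fk; exact: nbhsx_ballx.
  have b2 : ball (d (k + 1)) (e%:num / 4) (g n (k + 1)).
    near: n; have [_ gk] := dP (k + 1).
    by apply: gk; exact: nbhsx_ballx.
  have b3 : ball (f (g n k)) (e%:num / 2) (g n (k + 1)).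
    have [_ + _] := gP n => /(_ k); have kn : (absz k <= n)%N by near: n.
    move=> /(_ kn); apply: le_ball; apply: ltW; near: n; apply: ooG.
    exact: near_infty_natSinv_lt (PosNum e2).
  have := ball_triangle (ball_triangle b1 b3) (ball_sym b2).
  by congr (ball _ _ _); lra.
(* The limit is a full orbit in [M], so [V] is a neighbourhood of [d 0] and contains some [g n 0],
   against the choice of [g]. *)
have /IV dV : Defs.Inv f M (d 0).
  by exists d; split => // k; have [] := dP k.
have [_ g0] := dP 0.
have /(@filter_ex _ G)[n Vn] : G (fun n => V (g n 0)) by exact: g0 _ dV.
by have [_ _] := gP n.
Unshelve. all: by end_near. Qed.

(** An orbit segment of length [2n], re-centred at its midpoint, is a pseudo-orbit without jumps;
    [absz] only makes the indexing total. *)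
Lemma orbit_isolation (M V : set X) : compact M -> Defs.Inv f M `<=` V^° ->
  exists n0, forall n, (n0 <= n)%N -> forall x,
    (forall i, (i <= n.*2)%N -> M (iter i f x)) -> V (iter n f x).
Proof.
move=> cM /(pseudo_orbit_isolation cM)[n0 n0P]; exists n0 => n n0n x Mx.
have := n0P (fun k => iter (absz (k + n%:Z)) f x); rewrite add0r; apply.
  by move=> k kn; apply: Mx; lia.
move=> k kn; have -> : absz (k + 1 + n%:Z) = (absz (k + n%:Z)).+1 by lia.
by apply: ballxx; rewrite invr_gt0.
Qed.

End isolation.

(** * Continuity on pointed quotients *)

Section pair_quotient_continuity.
Context {X : topologicalType} (N L : set X).

(** This is continuity relative to [N]: points outside [N] are sent to the base point, so nothing is
    claimed about them. *)
Lemma pair_class_near (x : X) (U : set (pair_quotient N L)) :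
  N x -> nbhs (pair_class N L x) U ->
  \forall y \near x, N y -> U (pair_class N L y).
Proof.
move=> Nx; rewrite nbhsE => -[G [oG Gx] GU].
have [B oB BG] := iffLR (pair_quotient_openP G) oG.
have Bx : nbhs x B.
  apply: open_nbhs_nbhs; split=> //.
  by rewrite -[B x]/((\val @^-1` B) (SigSub (mem_set Nx) : N)) BG.
apply: filterS Bx => y By Ny; apply: GU.
by have : (\val @^-1` B) (SigSub (mem_set Ny) : N) by []; rewrite BG.
Qed.

(** The universal property of the quotient, phrased with neighbourhoods in [X] instead of the
    subtype [N]. *)
Lemma pair_quotient_continuous (Z : topologicalType)
    (h : pair_quotient N L -> Z) :
  (forall x, N x -> forall U, nbhs (h (pair_class N L x)) U ->
    \forall y \near x, N y -> U (h (pair_class N L y))) -> continuous h.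
Proof.
move=> hP; apply/continuousP => A oA; apply/pair_quotient_openP.
rewrite openE => x /= Ax; have Nx : N (\val x) := set_mem (valP x).
have := hP _ Nx A; move/(_ (open_nbhs_nbhs (conj oA Ax))) => nA.
apply: (@filterS _ (nbhs x) _ _ _ _ (@val_continuous _ N x _ nA)) => y; apply.
exact: set_mem (valP y).
Qed.

Lemma pair_class_eq_base (x : X) :
  pair_class N L x = pair_base N L <-> ~ (N `\` L) x.
Proof.
split=> [+ [Nx Lx]|Wx].
  have Nx' := mem_set Nx; rewrite /pair_class insubT.
  by move=> /eqmodP/predU1P[//|/andP[/= /set_mem]].
apply: pair_class_base; have [Nx|] := pselect (N x); last by left.
by right; apply: contrapT => Lx; exact: Wx.
Qed.

Lemma pair_base_closed : closed L -> closed [set pair_base N L].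
Proof.
move=> cL; rewrite -openC; apply/pair_quotient_openP.
have -> : [set x : N | (~` [set pair_base N L]) (pair_class N L (\val x))] =
          \val @^-1` (~` L).
  apply/seteqP; split=> x /=; have Nx : N (\val x) := set_mem (valP x).
    by move=> xb Lx; apply/xb/pair_class_eq_base => -[].
  by move=> Lx /pair_class_eq_base; apply.
apply: open_comp; last by rewrite openC.
by move=> x _; exact: val_continuous.
Qed.

(** The last two hypotheses are classical exit-set conditions. They make the index map equal to [[x]
    -> [f x]] on [N \ L], with values approaching the base point near [L]. *)
Lemma index_map_continuous (f : X -> X) : closed N -> closed L ->
  continuous f -> (forall x, L x -> N (f x) -> L (f x)) ->
  (forall x, (N `\` L) x -> N (f x)) ->
  continuous (Defs.index_map f (N := N) (L := L)).
Proof.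
move=> cN cL cf fL fNL; have imE x : (N `\` L) x ->
    Defs.index_map f (pair_class N L x) = pair_class N L (f x).
  move=> Wx; have [Wfx|Wfx] := pselect ((N `\` L) (f x)).
    exact: index_mapE.
  rewrite index_map_exit; last by case.
  rewrite pair_class_base//.
  have [Lfx|Lfx] := pselect (L (f x)); [by right|left].
  by move=> Nfx; apply: Wfx.
have near_out (A : set X) x : closed A -> ~ A x -> \forall y \near x, ~ A y.
  by move=> cA Ax; apply: open_nbhs_nbhs; split=> //; rewrite openC.
apply: pair_quotient_continuous => x Nx U.
have [Lx|Lx] := pselect (L x).
  rewrite index_map_exit; last by move=> [[]].
  move=> Ub.
  have imU y :
      Defs.index_map f (pair_class N L y) = pair_base N L \/ (N `\` L) y.
    have [Wy|Wy] := pselect ((N `\` L) y); first by right.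
    by left; rewrite index_map_exit// => -[].
  (* If [f x] is in [N], it is in [L], so the base point is [[f x]]; otherwise points near [x] also
     map out of [N], hence are not in [N \ L]. *)
  have [Nfx|Nfx] := pselect (N (f x)).
    have := @pair_class_near (f x) U Nfx.
    rewrite (pair_class_base (or_intror (fL _ Lx Nfx))) => /(_ Ub) /cf nU.
    apply: (@filterS _ (nbhs x) _ _ _ _ nU) => y /= Uy Ny.
    have [->|Wy] := imU y; first exact: nbhs_singleton.
    by rewrite imE//; apply: Uy; exact: fNL.
  apply: (@filterS _ (nbhs x) _ _ _ _ (cf _ _ (near_out _ _ cN Nfx))).
  move=> y /= Nfy _.
  have [->|/fNL//] := imU y; exact: nbhs_singleton.
rewrite imE// => /(pair_class_near (fNL _ (conj Nx Lx))) /cf fU.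
near=> y => Ny; rewrite imE; last by split=> //; near: y; exact: near_out.
have Ly : ~ L y by near: y; exact: near_out.
have : N (f y) by exact: fNL.
by near: y.
Unshelve. all: by end_near. Qed.

End pair_quotient_continuity.

Section index_pair_existence.
Context {R : realType} {X : metricType R}.

Lemma ball_nbhs (x y : X) (e : R) : ball x e y -> nbhs y (ball x e).
Proof.
rewrite ballEmdist/= => xy.
have e0 : 0 < e - mdist x y by rewrite subr_gt0.
apply: filterS (nbhsx_ballx y _ e0) => z; rewrite !ballEmdist/= => yz.
by apply: le_lt_trans (metric_triangle x y z) _; rewrite -ltrBrDl.
Qed.

(** The filter [F] describes large enough compact subsets of [M]; being directed by unions, it turns
    the near-covering form of compactness into a finite-union argument. *)
Lemma compact_nbhs_within (S M : set X) : locally_compact [set: X] ->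
  compact S -> S `<=` M^° -> exists K, [/\ compact K, K `<=` M & S `<=` K^°].
Proof.
move=> lcX cS SM; pose D := [set K : set X | compact K /\ K `<=` M].
pose F := filter_from D (fun K0 => [set K | D K /\ K0 `<=` K]).
have FF : Filter F.
  apply: filter_from_filter; first by exists set0; split; [exact: compact0|].
  move=> K0 K1 [cK0 K0M] [cK1 K1M]; exists (K0 `|` K1).
    by split; [exact: compactU|rewrite subUset].
  by move=> K [DK]; rewrite subUset => -[K0K K1K]; split.
have : \forall K \near F, S `<=` K^°.
  move/compact_near_coveringP : cS; apply => // x Sx.
  have [B] := lcX x I; rewrite withinET => Bx [cB clB].
  have [C Cx CM] := uniform_regular (SM _ Sx).
  have BCx : nbhs x (B `&` closure C).
    by apply: filterI => //; apply: filterS Cx; exact: subset_closure.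
  exists ((B `&` closure C)^°, [set K | D K /\ B `&` closure C `<=` K]).
    split; first exact: nbhs_interior.
    exists (B `&` closure C) => //; split; last by move=> y [_ /CM].
    by apply: compact_closedI => //; exact: closed_closure.
  by move=> [y K] /= [/= By [_ BK]]; exact: interiorS By.
move=> [K [cK KM] KP]; exists K; split=> //.
exact: (KP K (conj (conj cK KM) (fun _ => id))).
Qed.

(** A Lebesgue number argument: if the [e]-ball at [x] lies in [M], so does the [e/2]-ball at each
    point within [e/2] of [x]. *)
Lemma uniform_ball_within (S M : set X) : compact S -> S `<=` M^° ->
  exists2 e : R, 0 < e & forall x, S x -> ball x e `<=` M.
Proof.
move=> cS SM.
have nS : \forall e \near 0^'+, S `<=` (fun x : X => ball x e `<=` M).
  move/compact_near_coveringP : cS; apply => // x /SM/nbhs_ballP[e /= e0 eM].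
  have e2 : 0 < e / 2 by rewrite divr_gt0.
  exists (ball x (e / 2), [set d | d <= e / 2]).
    split; first exact: nbhsx_ballx.
    exact: nbhs_right_le.
  move=> [y d] /= [xy de] z yz; apply: eM.
  by have := ball_triangle xy (le_ball de yz); rewrite -splitr.
have : \forall e \near 0^'+,
    0 < e /\ S `<=` (fun x : X => ball x e `<=` M).
  by apply: filterI => //; exact: nbhs_right_gt.
by move=> /filter_ex[e [e0 eM]]; exists e.
Qed.

(* With [P] the points of [K] ending a backward-infinite [e]-chain in [K] and
   [Q] those starting a forward-infinite one, the pair is [N = closure P] and
   [L = N `\` Q]: for small [e] every point of [N `&` Q] lies on a bi-infinite
   chain, hence close to [S]. *)
Lemma index_pair_exists (f : X -> X) (S : set X) :
  locally_compact [set: X] -> continuous f -> isolated_invariant f S ->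
  exists N L, index_pair f S N L.
Proof.
move=> lcX cf [cS [M [SM MS]]].
have [K [cK KM SK]] := compact_nbhs_within lcX cS SM.
have SsubK : S `<=` K by apply: subset_trans SK _; exact: interior_subset.
have KS : Defs.Inv f K = S.
  rewrite -MS; apply: Inv_idem => //; first by rewrite MS.
have clK : closed K := compact_closed (@metric_hausdorff _ X) cK.
have [e0 e00 e0K] := uniform_ball_within cS SK.
have e02 : 0 < e0 / 2 by rewrite divr_gt0.
(* Points of [V] have a margin [e0/2] inside [K]. *)
pose V := [set x : X | ball x (e0 / 2) `<=` K].
have SV : Defs.Inv f K `<=` V^°.
  rewrite KS => x Sx; apply: filterS (nbhsx_ballx x _ e02) => y xy z yz.
  apply: (e0K _ Sx).
  by have := ball_triangle xy yz; rewrite -splitr.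
have [n nV] := pseudo_orbit_isolation cf cK SV.
(* The first bound makes [nV] apply to [d]-chains, the second keeps images within the margin of [V];
   [e = d/2] leaves room for passing from [P] to its closure. *)
pose d := Num.min n.+1%:R^-1 (e0 / 2).
have d0 : 0 < d by rewrite lt_min e02 invr_gt0 ltr0n.
pose e := d / 2.
have e_gt0 : 0 < e by rewrite divr_gt0.
(* Infinite chains are encoded coinductively: [P] and [Q] are the largest subsets of [K] in which
   every point has a predecessor, respectively a successor, up to [e]. *)
pose P := [set x | exists A : set X, [/\ A `<=` K,
  forall a, A a -> exists2 b, A b & ball (f b) e a & A x]].
pose Q := [set x | exists A : set X, [/\ A `<=` K,
  forall a, A a -> exists2 b, A b & ball (f a) e b & A x]].
have PK : P `<=` K by move=> x [A [AK _ /AK]].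
have QK : Q `<=` K by move=> x [A [AK _ /AK]].
have Ppred x : P x -> exists2 b, P b & ball (f b) e x.
  move=> [A [AK Apred Ax]]; have [b Ab bx] := Apred _ Ax.
  by exists b => //; exists A.
have Qsucc x : Q x -> exists2 b, Q b & ball (f x) e b.
  move=> [A [AK Asucc Ax]]; have [b Ab bx] := Asucc _ Ax.
  by exists b => //; exists A.
have Padd b x : P b -> K x -> ball (f b) e x -> P x.
  move=> Pb Kx bx; exists (P `|` [set x]); split; last by right.
    by move=> y [/PK//|->].
  move=> y [/Ppred[c Pc cy]|->]; first by exists c => //; left.
  by exists b => //; left.
have Qadd b x : Q b -> K x -> ball (f x) e b -> Q x.
  move=> Qb Kx bx; exists (Q `|` [set x]); split; last by right.
    by move=> y [/QK//|->].
  move=> y [/Qsucc[c Qc cy]|->]; first by exists c => //; left.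
  by exists b => //; left.
have fS : f @` S = S by rewrite -KS Inv_image.
have SP : S `<=` P.
  move=> x Sx; exists S; split=> // a; rewrite -{1}fS => -[b Sb <-].
  by exists b => //; exact: ballxx.
have SQ : S `<=` Q.
  move=> x Sx; exists S; split=> // a Sa.
  by exists (f a); [rewrite -fS; exists a|exact: ballxx].
pose N := closure P.
have clN : closed N by exact: closed_closure.
have NK : N `<=` K.
  by rewrite [A in _ `<=` A](iffLR (closure_id K) clK); exact: closureS.
have cN : compact N := subclosed_compact clN cK NK.
have Npred x : N x -> exists2 b, N b & ball (f b) d x.
  move=> Nx; have [y [/Ppred[b Pb bty] xy]] := Nx _ (nbhsx_ballx x _ e_gt0).
  exists b; first exact: subset_closure.
  by have := ball_triangle bty (ball_sym xy); rewrite -splitr.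
have Nf x : N x -> K (f x) -> N (f x).
  move=> Nx Kfx; apply: subset_closure.
  have [y [Py fxy]] := Nx _ (cf x _ (nbhsx_ballx (f x) _ e_gt0)).
  by apply: Padd Py Kfx _; exact: ball_sym.
pose L := N `\` Q.
have NLE : N `\` L = N `&` Q by rewrite setDD.
(* [Q] is relatively open in [N]: the condition [ball (f x) e b] persists near [x], and [Qadd]
   applies there. *)
have clL : closed L.
  move=> x Lx; have Nx : N x by apply: clN; apply: closureS Lx => y [].
  split=> // /Qsucc[b Qb fxb].
  have [y [[Ny nQy] fyb]] := Lx _ (cf x _ (ball_nbhs (ball_sym fxb))).
  by apply: nQy; apply: Qadd Qb (NK _ Ny) _; exact: ball_sym.
have cL : compact L by apply: subclosed_compact clL cN _; exact: subDsetl.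
pose E := [set x | exists g : int -> X, [/\ g 0 = x, forall k, K (g k)
  & forall k, ball (f (g k)) d (g (k + 1))]].
have NQE : N `&` Q `<=` E.
  move=> x [Nx Qx].
  have [|g [g0 gNQ gS]] := bi_infinite_chain
      (r := fun a b => ball (f a) d b) Npred _ Nx Qx.
    move=> b /Qsucc[b' Qb' bb']; exists b' => //; apply: le_ball bb'.
    by rewrite /e ler_pdivrMr// ler_peMr// ?ler1n// ltW.
  by exists g; split=> // k; case: (gNQ k); [exact: NK|exact: QK].
have EV : E `<=` V.
  move=> x [g [<- gK gS]]; apply: nV => k _; first exact: gK.
  by apply: le_ball (gS k); rewrite ge_min lexx.
(* The next point [g 1] of the chain lies in [V], and [f x] is within the margin [e0/2] of it. *)
have Ef x : E x -> K (f x).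
  move=> [g [<- gK gS]].
  have /EV : E (g 1).
    exists (fun k => g (1 + k)); split=> [|k|k]; [by rewrite addr0|exact: gK|].
    by rewrite addrA; exact: gS.
  apply; apply: ball_sym; have := gS 0; rewrite add0r; apply: le_ball.
  by rewrite ge_min lexx orbT.
exists N, L; split=> //.
- by move=> x [].
- rewrite -KS; apply: Inv_idem.
    rewrite KS => x Sx; apply: subset_closure; rewrite NLE.
    split; last exact: SQ.
    by apply: subset_closure; exact: SP.
  apply: subset_trans NK; rewrite [X in _ `<=` X](iffLR (closure_id N) clN).
  by apply: closureS => x [].
(* Having the fixed predecessor [b] and the fixed successor [c] is an open condition, so it holds
   near [x] inside [K]. *)
- move=> x Sx; rewrite NLE.
  have [b Pb bx] := Ppred _ (SP _ Sx); have [c Qc xc] := Qsucc _ (SQ _ Sx).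
  have nP : nbhs x (ball (f b) e) by exact: ball_nbhs.
  have nQ : nbhs x (f @^-1` ball c e).
    by apply: cf; apply: ball_nbhs; exact: ball_sym.
  have nK : nbhs x K by exact: SK.
  apply: filterS (filterI nK (filterI nP nQ)) => y [Ky [by_ yc]]; split.
    by apply: subset_closure; exact: Padd Pb Ky by_.
  by apply: Qadd Qc Ky _; exact: ball_sym.
- apply: index_map_continuous => // x.
    move=> [Nx nQx] Nfx; split=> // Qfx; apply: nQx.
    by apply: Qadd Qfx (NK _ Nx) _; exact: ballxx.
  by rewrite NLE => NQx; apply: Nf; [case: NQx|exact/Ef/NQE].
Qed.

End index_pair_existence.

(** * Shift equivalence of index maps *)

Section index_map_iter.
Context {X : topologicalType} (f : X -> X) (N L : set X).
Local Notation W := (N `\` L).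
Local Notation k := (Defs.index_map f (N := N) (L := L)).

(** The base point is absorbing, so only a segment lying entirely in [W] avoids it. *)
Lemma iter_index_map (m : nat) (x : X) : iter m k (pair_class N L x) =
  if `[< forall i, (i <= m)%N -> W (iter i f x) >]
  then pair_class N L (iter m f x) else pair_base N L.
Proof.
elim: m => [|m IHm].
  case: asboolP => //= Wx; apply/pair_class_eq_base => W0; apply: Wx => i.
  by rewrite leqn0 => /eqP ->.
rewrite iterS IHm; case: asboolP => Wm; last first.
  rewrite index_map_base; case: asboolP => // Wm1.
  by exfalso; apply: Wm => i im; apply: Wm1; rewrite leqW.
have Wfm : W (iter m f x) by exact: Wm.
case: asboolP => Wm1; first by rewrite index_mapE//; exact: (Wm1 m.+1).
rewrite index_map_exit// => -[_ Wfm1]; apply: Wm1 => i.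
by rewrite leq_eqVlt => /predU1P[->//|]; exact: Wm.
Qed.

Lemma iter_index_map_base (m : nat) : iter m k (pair_base N L) = pair_base N L.
Proof. by elim: m => //= m ->; exact: index_map_base. Qed.

End index_map_iter.

Lemma iter_continuous (T : topologicalType) (f : T -> T) (m : nat) :
  continuous f -> continuous (iter m f).
Proof.
move=> cf; elim: m => [|m IHm] x; first exact: cvg_id.
exact: (continuous_compT IHm cf).
Qed.

Section pair_class_image.
Context {X : topologicalType} (N L : set X).

(** A set in [N] disjoint from [L] is saturated, so its image pulls back to itself. *)
Lemma closed_pair_class_image (C : set X) : closed C -> C `<=` N `\` L ->
  closed (pair_class N L @` C).
Proof.
move=> clC CW; rewrite -openC; apply/pair_quotient_openP.
have -> : [set x : N | (~` (pair_class N L @` C)) (pair_class N L (\val x))] =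
          \val @^-1` (~` C).
  apply/seteqP; split=> x /= xC; first by move=> Cx; apply: xC; exists (\val x).
  move=> [y Cy] /pair_class_eqP-/(_ (CW _ Cy).1 (set_mem (valP x)))[yx|[Ly _]].
    by apply: xC; rewrite -yx.
  by have [] := CW _ Cy.
apply: open_comp; last by rewrite openC.
by move=> x _; exact: val_continuous.
Qed.

End pair_class_image.

Section pair_map.
Context {X Y : topologicalType} (N L : set X) (N' L' : set Y).
Context (D : set X) (h : X -> Y).

(** A partial map extended by the base point; for [D] inside [N \ L] it is independent of
    representatives, as classes there are singletons. *)
Definition pair_map (c : pair_quotient N L) : pair_quotient N' L' :=
  if repr c is Some x then
    if `[< D (\val x) >] then pair_class N' L' (h (\val x)) else pair_base N' L'
  else pair_base N' L'.

Hypothesis DW : D `<=` N `\` L.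

Lemma pair_mapE (x : X) : pair_map (pair_class N L x) =
  if `[< D x >] then pair_class N' L' (h x) else pair_base N' L'.
Proof.
rewrite /pair_map; have := reprK (pair_class N L x).
case: (repr _) => [u|] => [|/esym/pair_class_eq_base nWx]; last first.
  by case: asboolP => // /DW.
rewrite -pair_classE => ux; have Nu : N (\val u) := set_mem (valP u).
have [Nx|nNx] := pselect (N x).
  have [<-//|[Lu Lx]] := iffLR (pair_class_eqP L Nu Nx) ux.
  by rewrite !asboolF// => /DW[].
move: ux; rewrite (pair_class_base (or_introl nNx)) => /pair_class_eq_base nWu.
by rewrite !asboolF// => /DW // -[].
Qed.

Lemma pair_map_base : pair_map (pair_base N L) = pair_base N' L'.
Proof.
rewrite /pair_map; have := reprK (pair_base N L).
case: (repr _) => // u; rewrite -pair_classE => /pair_class_eq_base nWu.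
by rewrite asboolF// => /DW.
Qed.

End pair_map.

Section shift_combinatorics.
Context (n : nat) (F G : nat -> Prop).
Hypothesis FG :
  forall j, (forall i, (i <= n.*2)%N -> F (j + i)%N) -> G (j + n)%N.
Hypothesis GF :
  forall j, (forall i, (i <= n.*2)%N -> G (j + i)%N) -> F (j + n).+1.

(** [F i] and [G i] stand for [f^i x] in [W] and [phi (f^i x)] in [W']. The windows give [F] on
    [[0, 2n]] and [[4n+1, 6n+1]] and [G] on [[n, 5n]]; then [GF] fills the gap in [F]. *)
Lemma shift_comp_window :
  ((forall i, (i <= n.*2)%N -> F i) /\
   (forall i, (i <= n.*2)%N -> G (n + i)%N)) /\
  ((forall i, (i <= n.*2)%N -> G (3 * n + i)%N) /\
   (forall i, (i <= n.*2)%N -> F (3 * n + (n + i)).+1)) <->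
  forall i, (i <= (6 * n).+1)%N -> F i.
Proof.
split=> [[[F0 G0] [G1 F1]] i i6|F6].
  have [i2|i2] := leqP i n.*2; first exact: F0.
  have [i4|i4] := leqP i (4 * n).+1; last first.
    have -> : i = (3 * n + (n + (i - (4 * n).+1))).+1 by lia.
    by apply: F1; lia.
  have -> : i = (i - n.+1 + n).+1 by lia.
  apply: GF => j j2; have [l|l] := leqP (i - n.+1 + j) (3 * n).
    have -> : (i - n.+1 + j = n + (i - n.+1 + j - n))%N by lia.
    by apply: G0; lia.
  have -> : (i - n.+1 + j = 3 * n + (i - n.+1 + j - 3 * n))%N by lia.
  by apply: G1; lia.
have G6 i : (n <= i <= 5 * n)%N -> G i.
  move=> i6; have -> : (i = i - n + n)%N by lia.
  by apply: FG => j j2; apply: F6; lia.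
by split; split=> i i2; (apply: F6 || apply: G6); lia.
Qed.

(** Shifting both windows by one affects only their ends: [GF] supplies [F] at [2n+1], and [FG]
    supplies [G] at [n]. *)
Lemma shift_commute_window :
  F 0 /\ (forall i, (i <= n.*2)%N -> F i.+1) /\
    (forall i, (i <= n.*2)%N -> G (n + i).+1) <->
  ((forall i, (i <= n.*2)%N -> F i) /\
   (forall i, (i <= n.*2)%N -> G (n + i)%N)) /\
    G (3 * n).+1.
Proof.
split=> [[F0 [F1 G1]]|[[F0 G0] Gl]].
  have FS i : (i <= (n.*2).+1)%N -> F i.
    by case: i => // i; rewrite ltnS; exact: F1.
  split; last first.
    have -> : ((3 * n).+1 = (n + n.*2).+1)%N by lia.
    by apply: G1.
  split=> [i i2|[|i] i2]; first by apply: FS; lia.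
    by rewrite addn0 -[n]add0n; apply: FG => i i2'; apply: FS; lia.
  by rewrite addnS; apply: G1; lia.
split; first exact: F0.
split=> i i2.
  have [il|il] := ltnP i n.*2; first exact: F0.
  have -> : i.+1 = (n + n).+1 by lia.
  exact: GF.
have [il|il] := ltnP i n.*2; first by rewrite -addnS; exact: G0.
have -> : ((n + i).+1 = (3 * n).+1)%N by lia.
exact: Gl.
Qed.

End shift_combinatorics.

Section shift_maps.
Context {X Y : topologicalType} (phi : X -> Y) (psi : Y -> X).
Context (N L : set X) (N' L' : set Y) (n : nat).
Local Notation f := (psi \o phi).
Local Notation g := (phi \o psi).
Local Notation W := (N `\` L).
Local Notation W' := (N' `\` L').
Local Notation k := (Defs.index_map f (N := N) (L := L)).
Local Notation l := (Defs.index_map g (N := N') (L := L')).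

Lemma iter_intertwine (m : nat) (x : X) : iter m g (phi x) = phi (iter m f x).
Proof. by elim: m => //= m ->. Qed.

Definition shift_dom : set X :=
  [set x | (forall i, (i <= n.*2)%N -> W (iter i f x)) /\
           (forall i, (i <= n.*2)%N -> W' (phi (iter (n + i) f x)))].

Definition shift_map : pair_quotient N L -> pair_quotient N' L' :=
  pair_map N' L' shift_dom (phi \o iter (3 * n) f).

Lemma shift_dom_sub : shift_dom `<=` W.
Proof. by move=> x [Wx _]; exact: (Wx 0). Qed.

Lemma shift_mapE (x : X) : shift_map (pair_class N L x) =
  if `[< shift_dom x >] then pair_class N' L' (phi (iter (3 * n) f x))
  else pair_base N' L'.
Proof. exact: pair_mapE shift_dom_sub x. Qed.

Lemma shift_map_base : shift_map (pair_base N L) = pair_base N' L'.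
Proof. exact: pair_map_base shift_dom_sub. Qed.

(** Interiors are required because continuity of [shift_map] needs the conclusion at nearby points
    as well. *)
Hypothesis phiW : forall x, (forall i, (i <= n.*2)%N -> W (iter i f x)) ->
  W'^° (phi (iter n f x)).
Hypothesis psiW : forall y, (forall i, (i <= n.*2)%N -> W' (iter i g y)) ->
  W^° (psi (iter n g y)).

Lemma window_phi x j :
  (forall i, (i <= n.*2)%N -> W (iter (j + i) f x)) ->
  W' (phi (iter (j + n) f x)).
Proof.
move=> Wx; apply: interior_subset; rewrite addnC iterD; apply: phiW => i i2.
by rewrite -iterD addnC; exact: Wx.
Qed.

Lemma window_psi_interior x j :
  (forall i, (i <= n.*2)%N -> W' (phi (iter (j + i) f x))) ->
  W^° (iter (j + n).+1 f x).
Proof.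
move=> Wx; rewrite addnC iterS iterD /= -iter_intertwine; apply: psiW => i i2.
by rewrite iter_intertwine -iterD addnC; exact: Wx.
Qed.

Lemma window_psi x j :
  (forall i, (i <= n.*2)%N -> W' (phi (iter (j + i) f x))) ->
  W (iter (j + n).+1 f x).
Proof. by move=> /window_psi_interior; exact: interior_subset. Qed.

(** By [shift_commute_window] both sides are the class of [phi (f^(3n+1) x)] under the same
    conditions, and the base point otherwise. *)
Lemma shift_map_commute (c : pair_quotient N L) :
  shift_map (k c) = l (shift_map c).
Proof.
have [->|[x Nx ->]] := pair_class_surj c.
  by rewrite index_map_base shift_map_base index_map_base.
have comb := shift_commute_window
  (F := fun i => W (iter i f x)) (G := fun i => W' (phi (iter i f x)))
  (window_phi (x := x)) (window_psi (x := x)).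
rewrite shift_mapE.
have [Dx|Dx] := asboolP (shift_dom x); last first.
  rewrite index_map_base; have [Wx|Wx] := pselect (W x /\ W (f x)); last first.
    by rewrite index_map_exit// shift_map_base.
  rewrite index_mapE; [|by case: Wx..].
  rewrite shift_mapE asboolF// => -[F1 G1]; apply: Dx.
  have [] := iffLR comb; last by [].
  split; first by case: Wx.
  by split=> i i2; [rewrite iterSr; exact: F1|rewrite iterSr; exact: G1].
have Gn : W' (phi (iter (3 * n) f x)).
  by have -> : (3 * n = n + n.*2)%N; [lia|exact: Dx.2].
have [Gl|Gl] := pselect (W' (phi (iter (3 * n).+1 f x))).
  have [F0 [F1 G1]] := iffRL comb (conj Dx Gl).
  rewrite [RHS]index_mapE// index_mapE//; last 1 first.
    by have := F1 0; apply.
  rewrite shift_mapE asboolT -?iterSr//.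
  by split=> i i2; rewrite -iterSr; [exact: F1|exact: G1].
rewrite [RHS]index_map_exit; last by case.
have [Wx|Wx] := pselect (W x /\ W (f x)); last first.
  by rewrite index_map_exit// shift_map_base.
rewrite index_mapE; [|by case: Wx..].
rewrite shift_mapE asboolF// => -[F1 G1]; apply: Gl.
have [] := iffLR comb; last by [].
split; first by case: Wx.
by split=> i i2; [rewrite iterSr; exact: F1|rewrite iterSr; exact: G1].
Qed.

(** On the relatively open set [O] the map is [l^(2n) [phi (f^n x)]], and off [O] it is the base
    point; the delicate points are those outside [O] that are limits of points of [O]. *)
Lemma shift_map_continuous : continuous phi -> continuous psi ->
  regular_space X -> closed L -> closed N' ->
  continuous k -> continuous l -> continuous shift_map.
Proof.
move=> cphi cpsi regX clL clN' ck cl.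
have cf m : continuous (iter m f).
  by apply: iter_continuous; exact: continuous_compT cphi cpsi.
have cpf m : continuous (phi \o iter m f).
  exact: continuous_compT (cf m) cphi.
pose O x := forall i, (i <= n.*2)%N -> W (iter i f x).
have rO x : O x -> shift_map (pair_class N L x) =
    iter n.*2 l (pair_class N' L' (phi (iter n f x))).
  move=> Ox; rewrite shift_mapE iter_index_map.
  have -> : iter n.*2 g (phi (iter n f x)) = phi (iter (3 * n) f x).
    by rewrite iter_intertwine -iterD; congr (phi (iter _ f x)); lia.
  congr (if _ then _ else _); apply: asbool_equiv_eq; split=> [[_ Gx] i i2|Gx].
    by rewrite iter_intertwine -iterD addnC; exact: Gx.
  by split=> // i i2; have := Gx _ i2; rewrite iter_intertwine -iterD addnC.
have rnO x : ~ O x -> shift_map (pair_class N L x) = pair_base N' L'.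
  by move=> nOx; rewrite shift_mapE asboolF// => -[].
have OE m x : iter m k (pair_class N L x) = pair_base N L <->
    ~ forall i, (i <= m)%N -> W (iter i f x).
  rewrite iter_index_map; case: asboolP => // Wx; split=> [|//].
  by move=> /pair_class_eq_base nW; have := Wx _ (leqnn m).
have near_l (x : X) (U : set (pair_quotient N' L')) : N' (phi (iter n f x)) ->
    nbhs (iter n.*2 l (pair_class N' L' (phi (iter n f x)))) U ->
    \forall y \near x, N' (phi (iter n f y)) ->
      U (iter n.*2 l (pair_class N' L' (phi (iter n f y)))).
  move=> Nx Ux; have {}Ux := iter_continuous (m := n.*2) cl Ux.
  exact: (cpf n x _ (pair_class_near Nx Ux)).
apply: pair_quotient_continuous => x Nx U.
have [Ox|nOx] := pselect (O x).
  have WOx := phiW Ox; have NOx := (interior_subset WOx).1.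
  rewrite rO// => /(near_l _ _ NOx) nU.
  (* [O] is where [k^(2n)] avoids the base point, which is closed. *)
  have nO : \forall y \near x, N y -> O y.
    have nb : nbhs (pair_class N L x)
        (iter n.*2 k @^-1` ~` [set pair_base N L]).
      apply: (iter_continuous (m := n.*2) ck); apply: open_nbhs_nbhs; split.
        by rewrite openC; exact: pair_base_closed.
      by move=> /OE.
    apply: filterS (pair_class_near Nx nb) => y Ny /Ny yO.
    by apply: contrapT => /OE.
  have nN' : \forall y \near x, N' (phi (iter n f y)).
    by apply: (cpf n x); apply: filterS WOx => y [].
  apply: filterS (filterI nU (filterI nO nN')) => y [Uy [Oy N'y]] Ny.
  by rewrite rO//; [exact: Uy|exact: Oy].
rewrite rnO// => Ub.
suff near_b : \forall y \near x, N y -> O y ->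
    U (iter n.*2 l (pair_class N' L' (phi (iter n f y)))).
  apply: filterS near_b => y Uy Ny; have [Oy|nOy] := pselect (O y).
    by rewrite rO//; exact: Uy.
  by rewrite rnO//; exact: nbhs_singleton.
have [N'x|nN'x] := pselect (N' (phi (iter n f x))); last first.
  have nN' : nbhs (phi (iter n f x)) (~` N').
    by apply: open_nbhs_nbhs; split=> //; rewrite openC.
  apply: (@filterS _ (nbhs x) _ _ _ _ (cpf n x _ nN')) => y nN'y _ Oy.
  by have /interior_subset[] := phiW Oy.
have [bx|bx] := pselect (iter n.*2 l (pair_class N' L' (phi (iter n f x))) =
    pair_base N' L').
  have := near_l x U N'x; rewrite bx => /(_ Ub) nU.
  by apply: filterS nU => y Uy _ /phiW/interior_subset[N'y _]; exact: Uy.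
(* The second window of [x] is entirely in [W'], so [f^(2n+1) x] is in the interior of [W] although
   some earlier iterate is outside [W]. *)
have Wx : W^° (iter (n + n).+1 f x).
  apply: window_psi_interior => i i2.
  move: bx; rewrite iter_index_map; case: asboolP => // Gx _.
  by have := Gx _ i2; rewrite iter_intertwine -iterD addnC.
have [C Cx CW] := regX _ _ Wx.
(* Otherwise [iter (n + n).+1 k] would be discontinuous at [pair_class N L x],
   where its value is the base point. *)
suff : \forall y \near x, N y -> ~ O y.
  by apply: filterS => y nOy Ny; have := nOy Ny.
have clZ : closed (pair_class N L @` closure C).
  by apply: closed_pair_class_image => //; exact: closed_closure.
have nZ : nbhs (iter (n + n).+1 k (pair_class N L x))
    (~` (pair_class N L @` closure C)).
  apply: open_nbhs_nbhs; split; first by rewrite openC.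
  have -> : iter (n + n).+1 k (pair_class N L x) = pair_base N L.
    by apply/OE => Wx1; apply: nOx => i i2; apply: Wx1; lia.
  by move=> [z /CW Wz /pair_class_eq_base].
have nZ' := pair_class_near Nx (iter_continuous (m := (n + n).+1) ck nZ).
apply: (@filterS _ (nbhs x) _ _ _ _ (filterI nZ' (cf _ x _ Cx))).
move=> y [Zy /= Cy] Ny Oy.
have CCy : closure C (iter (n + n).+1 f y) by exact: subset_closure.
apply: (Zy Ny); exists (iter (n + n).+1 f y) => //.
rewrite iter_index_map asboolT// => i.
rewrite leq_eqVlt ltnS addnn => /predU1P[->|]; last exact: Oy.
by rewrite -addnn; exact: CW.
Qed.

End shift_maps.

Arguments shift_dom {X Y} phi psi N L N' L' n _.
Arguments shift_map {X Y} phi psi N L N' L' n c.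

Section shift_maps_comp.
Context {X Y : topologicalType} (phi : X -> Y) (psi : Y -> X).
Context (N L : set X) (N' L' : set Y) (n : nat).
Local Notation f := (psi \o phi).
Local Notation g := (phi \o psi).
Local Notation W := (N `\` L).
Local Notation W' := (N' `\` L').

Hypothesis phiW : forall x, (forall i, (i <= n.*2)%N -> W (iter i f x)) ->
  W'^° (phi (iter n f x)).
Hypothesis psiW : forall y, (forall i, (i <= n.*2)%N -> W' (iter i g y)) ->
  W^° (psi (iter n g y)).

Lemma shift_map_comp (c : pair_quotient N L) :
  shift_map psi phi N' L' N L n (shift_map phi psi N L N' L' n c) =
  iter (6 * n).+1 (Defs.index_map f (N := N) (L := L)) c.
Proof.
have [->|[x Nx ->]] := pair_class_surj c.
  by rewrite iter_index_map_base !shift_map_base.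
(* The pair [psi], [phi] around the iterates of [g] contributes one more [f], whence the exponent
   [3n + 3n + 1]. *)
have gf i j : psi (iter i g (phi (iter j f x))) = iter (j + i).+1 f x.
  by rewrite iter_intertwine -iterD addnC.
have D'E : shift_dom psi phi N' L' N L n (phi (iter (3 * n) f x)) <->
    (forall i, (i <= n.*2)%N -> W' (phi (iter (3 * n + i) f x))) /\
    (forall i, (i <= n.*2)%N -> W (iter (3 * n + (n + i)).+1 f x)).
  rewrite /shift_dom /=; split=> -[G1 F1]; split=> i i2.
  - by have := G1 _ i2; rewrite iter_intertwine -iterD addnC.
  - by have := F1 _ i2; rewrite gf.
  - by rewrite iter_intertwine -iterD addnC; exact: G1.
  - by rewrite gf; exact: F1.
have comb := shift_comp_window
  (F := fun i => W (iter i f x)) (G := fun i => W' (phi (iter i f x)))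
  (window_phi phiW (x := x)) (window_psi psiW (x := x)).
rewrite iter_index_map shift_mapE.
have [Dx|nDx] := asboolP (shift_dom phi psi N L N' L' n x); last first.
  rewrite shift_map_base asboolF// => F6.
  by have [[F0 G0] _] := iffRL comb F6; exact: nDx.
rewrite shift_mapE gf.
have -> : (3 * n + 3 * n).+1 = (6 * n).+1 by lia.
congr (if _ then _ else _); apply: asbool_equiv_eq; split=> [/D'E D'x|F6].
  exact: iffLR comb (conj Dx D'x).
by apply/D'E; have [] := iffRL comb F6.
Qed.

End shift_maps_comp.

(** * Comparison of index pairs for the two compositions *)

Section index_pairs_of_compositions.
Context {R : realType}.

Lemma index_pair_compact_closure (X : metricType R) (f : X -> X)
    (S N L : set X) :
  index_pair f S N L -> compact (closure (N `\` L)).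
Proof.
move=> [cN _ _ _ _ _].
have clN : closed N := compact_closed (@metric_hausdorff _ X) cN.
apply: subclosed_compact cN _; first exact: closed_closure.
rewrite [A in _ `<=` A](iffLR (closure_id N) clN).
by apply: closureS => x [].
Qed.

(** [orbit_isolation] applies to the compact closure of [N \ L]. Validity for all [n >= n0] lets one
    [n] serve both directions. *)
Lemma index_pair_window (X Y : metricType R) (f : X -> X) (h : X -> Y)
    (S N L : set X) (W : set Y) :
  continuous f -> continuous h -> index_pair f S N L -> h @` S `<=` W^° ->
  exists n0, forall n, (n0 <= n)%N -> forall x,
    (forall i, (i <= n.*2)%N -> (N `\` L) (iter i f x)) ->
    W^° (h (iter n f x)).
Proof.
move=> cf ch ip hS; have [_ _ _ NS _ _] := ip.
have [|n0 n0P] := orbit_isolation (V := [set x | W^° (h x)]) cf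
    (index_pair_compact_closure ip).
  rewrite NS => x Sx; apply: (ch x (W^°)); apply: nbhs_interior; apply: hS.
  by exists x.
exists n0 => n n0n x Wx; apply: n0P => // i i2.
by apply: subset_closure; exact: Wx.
Qed.

Lemma index_pairs_torus (X Y : metricType R) (phi : X -> Y) (psi : Y -> X)
    (S N L : set X) (N' L' : set Y) :
  continuous phi -> continuous psi ->
  index_pair (psi \o phi) S N L ->
  index_pair (phi \o psi) (phi @` S) N' L' ->
  homotopy_equivalent R
    (mapping_torus R (Defs.index_map (psi \o phi) (N := N) (L := L)))
    (mapping_torus R (Defs.index_map (phi \o psi) (N := N') (L := L'))).
Proof.
move=> cphi cpsi ip ip'.
have [cN cL _ NS SW ck] := ip; have [cN' cL' _ _ SW' cl] := ip'.
have clN := compact_closed (@metric_hausdorff _ X) cN.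
have clL := compact_closed (@metric_hausdorff _ X) cL.
have clN' := compact_closed (@metric_hausdorff _ Y) cN'.
have clL' := compact_closed (@metric_hausdorff _ Y) cL'.
have cf := continuous_compT cphi cpsi; have cg := continuous_compT cpsi cphi.
(* [psi (phi S)] is the image of [S] under [psi \o phi], that is, [S]. *)
have psiS : psi @` (phi @` S) `<=` (N `\` L)^°.
  by rewrite image_comp -NS Inv_image NS.
have [n0 n0P] := index_pair_window cf cphi ip SW'.
have [n1 n1P] := index_pair_window cg cpsi ip' psiS.
have phiW := n0P _ (leq_maxl n0 n1); have psiW := n1P _ (leq_maxr n0 n1).
apply: (shift_equivalent_torus
  (r := shift_map phi psi N L N' L' (maxn n0 n1))
  (s := shift_map psi phi N' L' N L (maxn n0 n1))
  (m := (6 * maxn n0 n1).+1)) => //.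
- by apply: shift_map_continuous => //; exact: uniform_regular.
- by apply: shift_map_continuous => //; exact: uniform_regular.
- exact: shift_map_commute.
- exact: shift_map_commute.
- exact: shift_map_comp.
- exact: shift_map_comp.
Qed.

End index_pairs_of_compositions.

Lemma isolated_invariant_comp (X Y : topologicalType) (phi : X -> Y)
    (psi : Y -> X) (S : set X) : continuous phi -> continuous psi ->
  isolated_invariant (psi \o phi) S ->
  isolated_invariant (phi \o psi) (phi @` S).
Proof.
move=> cphi cpsi [cS [M [SM MS]]]; split.
  by apply: continuous_compact => //; exact: continuous_subspaceT.
exists (psi @^-1` M); split.
  move=> _ [x Sx <-]; apply: (cpsi (phi x)); apply: SM.
  by rewrite -MS -Inv_image MS; exists x.
apply/seteqP; split=> [y [g [Mg <- gS]]|_ [x Sx <-]].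
  (* Applying [phi] to this point gives [g 0], one step of [phi \o psi] after [g (-1)]. *)
  exists (psi (g (-1))); last by have := gS (-1); rewrite addNr => ->.
  rewrite -MS; apply: (@Inv_orbit _ _ M (psi \o g)) => // n.
  by rewrite /= gS.
(* The orbit [phi \o g] stays in the preimage of [M] because [psi (phi (g n))] is [g (n + 1)]. *)
move: Sx; rewrite -MS => -[g [Mg <- gS]]; exists (phi \o g); split=> // n.
  by rewrite /preimage /=; have := gS n; rewrite /= => <-; exact: Mg.
by rewrite /= gS.
Qed.

Theorem theorem4p3 (R : realType) (X Y : metricType R)
  (lcX : locally_compact [set: X]) (lcY : locally_compact [set: Y])
  (phi : X -> Y) (psi : Y -> X)
  (cphi : continuous phi) (cpsi : continuous psi)
  (S : set X) (isoS : isolated_invariant (psi \o phi) S) :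
  isolated_invariant (phi \o psi) (phi @` S) /\
  (is_homotopy_type R (CT R (psi \o phi) S) /\
   CT R (psi \o phi) S = CT R (phi \o psi) (phi @` S)).
Proof.
have isoS' := isolated_invariant_comp cphi cpsi isoS.
have cf := continuous_compT cphi cpsi; have cg := continuous_compT cpsi cphi.
have [N [L ip]] := index_pair_exists lcX cf isoS.
have [N' [L' ip']] := index_pair_exists lcY cg isoS'.
pose Z := mapping_torus R (Defs.index_map (phi \o psi) (N := N') (L := L')).
have CTf : CT R (psi \o phi) S = fun Z' => homotopy_equivalent R Z' Z.
  apply/funext => Z'; apply/propext; split=> [[N1 [L1 [ip1 Z'N1]]]|Z'Z].
    exact: homotopy_equivalent_trans Z'N1 (index_pairs_torus cphi cpsi ip1 ip').
  exists N, L; split=> //; apply: homotopy_equivalent_trans Z'Z _.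
  exact: homotopy_equivalent_sym (index_pairs_torus cphi cpsi ip ip').
split=> //; split; first by exists Z.
rewrite CTf; apply/funext => Z'; apply/propext; split=> [Z'Z|].
  by exists N', L'.
(* Two index pairs of [phi(S)] are compared through the index pair [(N, L)] of [S]. *)
move=> [N1 [L1 [ip1 Z'N1]]]; apply: homotopy_equivalent_trans Z'N1 _.
apply: homotopy_equivalent_trans (index_pairs_torus cphi cpsi ip ip').
exact: homotopy_equivalent_sym (index_pairs_torus cphi cpsi ip ip1).
Qed.
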